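(* Let $T_1,\dots,T_d$ be infinite locally finite rooted trees, let $\mathcal P=T_1\times\dots\times T_d$ with the product order, and let $\Omega$ be a finite lower order ideal of $\mathcal P$. Fix $g:\mathbb Z_{\ge0}^d\to\mathbb R_{\ge0}$. For $\mathbf v\in\Omega$ define $$H(\mathbf v)=\sum_{\mathbf m\in\mathbb Z_{\ge0}^d} g(\mathbf m)\,\bigl|\{\mathbf w\in\Omega:\mathbf v\to_{\mathbf m}\mathbf w\}\bigr|,\qquad H^\ast(\mathbf v)=\sum_{\mathbf m\in\mathbb Z_{\ge0}^d} g(\mathbf m)\,\bigl|\{\mathbf w\in\Omega:\mathbf w\to_{\mathbf m}\mathbf v\}\bigr|.$$ Then the multiset $\{H(\mathbf v):\mathbf v\in\Omega\}$ majorizes the multiset $\{H^\ast(\mathbf v):\mathbf v\in\Omega\}$.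
   Context: Each $T_i$ has root $R_i$ and is viewed as a poset in which $x\preccurlyeq y$ means $x$ lies on the path from $y$ to $R_i$ (so $R_i$ is the minimum); $d_i(x)$ denotes the distance from $x$ to $R_i$ in $T_i$. The product $\mathcal P$ is ordered componentwise, and a lower order ideal $\Omega$ is a subset closed under going down (towards the roots). For $\mathbf v=(v_1,\dots,v_d)$, $\mathbf w=(w_1,\dots,w_d)\in\Omega$ and $\mathbf m=(m_1,\dots,m_d)\in\mathbb Z_{\ge0}^d$, write $\mathbf v\to_{\mathbf m}\mathbf w$ if $v_i\preccurlyeq w_i$ and $d_i(w_i)-d_i(v_i)=m_i$ for all $i$. Majorization: for two multisets $\mathcal A,\mathcal B$ of $n$ real numbers with elements $a_1\ge\dots\ge a_n$ and $b_1\ge\dots\ge b_n$ in non-increasing order, $\mathcal A$ majorizes $\mathcal B$ if $a_1+\dots+a_k\ge b_1+\dots+b_k$ for all $1\le k<n$ and $a_1+\dots+a_n=b_1+\dots+b_n$. *)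

(* Defs.v *)
From mathcomp Require Import all_boot all_order all_algebra.
From mathcomp Require Import finmap multiset.
From mathcomp Require Import boolp classical_sets functions cardinality fsbigop.
From mathcomp Require Import reals.

Set Implicit Arguments.
Unset Strict Implicit.
Unset Printing Implicit Defensive.

Import Order.TTheory GRing.Theory Num.Theory.

Local Open Scope classical_set_scope.
Local Open Scope fset_scope.
Local Open Scope ring_scope.

(* A rooted tree is a connected simple graph without cycles, with a chosen
   vertex.  [ucycle] allows the empty cycle and the back-and-forth closed walk
   [:: x; y] along an edge, hence the bound 2 on the size. *)
Record rooted_tree := RootedTree {
  vertex :> choiceType;
  tree_adj : rel vertex;
  tree_root : vertex;
  tree_adj_sym : symmetric tree_adj;
  tree_adj_irr : irreflexive tree_adj;
  tree_adj_connected : forall x y, exists p, path tree_adj x p /\ last x p = y;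
  tree_adj_acyclic : forall c, ucycle tree_adj c -> (size c <= 2)%N }.

Definition locally_finite (T : rooted_tree) : Prop :=
  forall x : T, finite_set [set y : T | tree_adj x y].

Definition walk_length (T : rooted_tree) (x y : T) (n : nat) : Prop :=
  exists p, [/\ path (@tree_adj T) x p, last x p = y & size p = n].

Lemma walk_length_ex (T : rooted_tree) (x y : T) :
  exists n, `[< walk_length x y n >].
Proof.
have [p [hp hl]] := tree_adj_connected x y.
by exists (size p); apply/asboolP; exists p.
Qed.

Definition tree_dist (T : rooted_tree) (x y : T) : nat := ex_minn (walk_length_ex x y).

Definition tree_depth (T : rooted_tree) (x : T) : nat := tree_dist x (tree_root T).

(* [x] lies on the (unique, simple) path from [y] to the root. *)
Definition tree_le (T : rooted_tree) (x y : T) : Prop :=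
  exists p, [/\ path (@tree_adj T) y p, last y p = tree_root T, uniq (y :: p)
              & x \in y :: p].

Definition tree_prod (d : nat) (T : 'I_d -> rooted_tree) : choiceType :=
  {dffun forall i : 'I_d, T i}.

Definition prod_le (d : nat) (T : 'I_d -> rooted_tree) (v w : tree_prod T) :
    Prop :=
  forall i, tree_le (v i) (w i).

Definition lower_ideal (d : nat) (T : 'I_d -> rooted_tree)
    (Omega : {fset tree_prod T}) : Prop :=
  forall v w, prod_le v w -> w \in Omega -> v \in Omega.

Definition arrow_by (d : nat) (T : 'I_d -> rooted_tree)
    (m : {ffun 'I_d -> nat}) (v w : tree_prod T) : Prop :=
  forall i, tree_le (v i) (w i) /\
    (tree_depth (w i))%:Z - (tree_depth (v i))%:Z = (m i)%:Z.

(* The sums over [m] range over all of N^d; for each [v] and [w] at most one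
   [m] satisfies [arrow_by m v w], so only finitely many terms are nonzero, as
   [\sum_(_ \in _)] requires. *)
Definition upsum (R : realType) (d : nat) (T : 'I_d -> rooted_tree)
    (Omega : {fset tree_prod T}) (g : {ffun 'I_d -> nat} -> R)
    (v : tree_prod T) : R :=
  \sum_(m \in [set: {ffun 'I_d -> nat}])
    g m * #|` [fset w in Omega | `[< arrow_by m v w >]] |%:R.

Definition downsum (R : realType) (d : nat) (T : 'I_d -> rooted_tree)
    (Omega : {fset tree_prod T}) (g : {ffun 'I_d -> nat} -> R)
    (v : tree_prod T) : R :=
  \sum_(m \in [set: {ffun 'I_d -> nat}])
    g m * #|` [fset w in Omega | `[< arrow_by m w v >]] |%:R.

Definition mset_image (K : choiceType) (R : realType) (A : {fset K})
    (f : K -> R) : {mset R}%mset :=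
  seq_mset [seq f x | x <- enum_fset A].

Definition largest_sum (R : realType) (k : nat) (A : {mset R}%mset) : R :=
  \sum_(x <- take k (sort >=%R (enum_mset A))) x.

Definition majorizes (R : realType) (A B : {mset R}%mset) : Prop :=
  [/\ size (enum_mset A) = size (enum_mset B),
      forall k, (1 <= k < size (enum_mset A))%N ->
        largest_sum k B <= largest_sum k A
    & \sum_(x <- enum_mset A) x = \sum_(x <- enum_mset B) x].

(* Main.v *)
(* Top sums are compared subset by subset: for S in Omega one finds S' in Omega
   with |S'| <= |S| such that, for every m, at least as many elements of Omega have
   their m-th ancestor in S' as there are elements of S of depth at least m.
   S' is obtained by treating the coordinates one after the other. In coordinate
   j every fibre of S, a finite set of vertices of the tree T_j, is pushed down
   towards the root until it is closed under taking parents. The key fact about a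
   single tree is that if X is pushed down to X', then for every down-closed Z
   and every k there are at least as many vertices of Z whose k-th ancestor
   exists and lies in X' as vertices of X and Z of depth at least k. *)
Require Import Defs.
From mathcomp Require Import all_boot all_order all_algebra.
From mathcomp Require Import finmap multiset.
From mathcomp Require Import boolp classical_sets functions cardinality fsbigop.
From mathcomp Require Import reals zify.

Set Implicit Arguments.
Unset Strict Implicit.
Unset Printing Implicit Defensive.

Import Order.TTheory GRing.Theory Num.Theory.

Local Open Scope classical_set_scope.
Local Open Scope ring_scope.

(** * Simple paths, parents and depth in a rooted tree *)

Section Tree.
Variable T : rooted_tree.
Implicit Types (x y z : T) (p q : seq T).

Local Notation adj := (@tree_adj T).

(** Following [p] to [z] and returning along the reverse of [q] gives a cycle without repetition;
    acyclicity leaves room only for [x] and [z]. *)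
Lemma meeting_paths_trivial x z p q :
  path adj x (rcons p z) -> path adj x (rcons q z) ->
  uniq (x :: rcons p z) -> uniq (x :: rcons q z) -> ~~ has (mem q) p ->
  p = [::] /\ q = [::].
Proof.
move=> Pp Pq Up Uq disj.
suff /(@tree_adj_acyclic T) : ucycle adj (x :: rcons p z ++ rev q).
  rewrite /= size_cat size_rcons size_rev => h.
  by split; apply/nilP; rewrite /nilp; lia.
apply/andP; split.
  rewrite /= rcons_cat cat_path Pp last_rcons /=.
  have := rev_path adj x (rcons q z).
  rewrite belast_rcons last_rcons rev_cons => ->.
  by rewrite (eq_path (e' := adj)) // => u v; rewrite tree_adj_sym.
move: Up Uq; rewrite /= !mem_rcons !inE !negb_or !rcons_uniq.
case/andP=> /andP[xz xp] /andP[zp Up] /andP[/andP[_ xq] /andP[zq Uq]].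
rewrite mem_cat mem_rcons inE !negb_or xz xp mem_rev xq /=.
rewrite cat_uniq rcons_uniq zp Up rev_uniq Uq /= andbT.
apply/hasPn => u; rewrite mem_rev => uq.
rewrite mem_rcons inE negb_or; apply/andP; split.
  by apply: contraNneq zq => <-.
by apply: contraNN disj => up; apply/hasP; exists u.
Qed.

(** If the first steps differ, cut both paths at the first vertex of the one that lies on the other.
    The initial pieces then have no interior vertices, so both first steps are that vertex after
    all. *)
Lemma simple_path_inj x p q :
  path adj x p -> uniq (x :: p) -> path adj x q -> uniq (x :: q) ->
  last x p = last x q -> p = q.
Proof.
elim: p x q => [|a p IH] x [|b q] //.
- by move=> _ _ _ /= /andP[xq _] xE; rewrite xE mem_last in xq.
- by move=> _ /= /andP[xq _] _ _ xE; rewrite -xE mem_last in xq.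
move=> Pp Up Pq Uq lE.
have [ab|neq_ab] := eqVneq a b.
  move: Pp Up Pq Uq lE; rewrite -ab /= => /andP[_ Pp] /andP[_ Up] /andP[_ Pq].
  by case/andP=> _ Uq lE; rewrite (IH a q).
have hasp : has (mem (b :: q)) (a :: p).
  apply/hasP; exists (last x (a :: p)); first by rewrite /= mem_last.
  by rewrite lE /= mem_last.
have [z [p1 [p2 [zq nhas pE]]]] : exists z p1 p2,
    [/\ z \in b :: q, ~~ has (mem (b :: q)) p1 & a :: p = rcons p1 z ++ p2].
  by case: (split_find hasp) => z p1 p2 zq nh; exists z, p1, p2.
have [q1 [q2 qE]] : exists q1 q2, b :: q = rcons q1 z ++ q2.
  by case: (path.splitP zq) => q1 q2; exists q1, q2.
have [|||||p10 q10] := @meeting_paths_trivial x z p1 q1.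
- by move: Pp; rewrite pE cat_path => /andP[].
- by move: Pq; rewrite qE cat_path => /andP[].
- by move: Up; rewrite pE -cat_cons cat_uniq => /andP[].
- by move: Uq; rewrite qE -cat_cons cat_uniq => /andP[].
- apply: contraNN nhas => /hasP[u up uq]; apply/hasP; exists u => //=.
  by rewrite qE mem_cat mem_rcons inE [u \in q1]uq orbT.
move: pE qE neq_ab; rewrite p10 q10 /= => -[-> _] [-> _].
by rewrite eqxx.
Qed.

Lemma root_path_ex x :
  exists p, [/\ path adj x p, last x p = tree_root T & uniq (x :: p)].
Proof.
have [p [Pp lp]] := tree_adj_connected x (tree_root T).
by move: lp; case: (shortenP Pp) => q Pq Uq _ lq; exists q.
Qed.

Definition root_path x : seq T := sval (cid (root_path_ex x)).

Lemma root_pathP x : [/\ path adj x (root_path x),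
  last x (root_path x) = tree_root T & uniq (x :: root_path x)].
Proof. by rewrite /root_path; case: cid. Qed.

Lemma root_path_unique x p : path adj x p -> last x p = tree_root T ->
  uniq (x :: p) -> p = root_path x.
Proof.
by have [? lr ?] := root_pathP x => *; apply: (@simple_path_inj x); rewrite ?lr.
Qed.

(** The default value of [head] makes the root its own parent, so iterating [parent] stops there. *)
Definition parent x : T := head x (root_path x).

Lemma root_pathE x :
  root_path x = [::] \/ root_path x = parent x :: root_path (parent x).
Proof.
have [] := root_pathP x; rewrite /parent.
case: (root_path x) => [|a p] /=; first by left.
case/andP=> _ Pp lp /andP[_ Up]; right.
by rewrite -(root_path_unique Pp lp Up).
Qed.

(** Any walk to the root shortens to a simple path, which is [root_path x] by uniqueness. *)
Lemma tree_depthE x : tree_depth x = size (root_path x).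
Proof.
rewrite /tree_depth /tree_dist; case: ex_minnP => n /asboolP[p [Pp lp <-]] min.
apply/eqP; rewrite eqn_leq; apply/andP; split.
  by apply: min; apply/asboolP; exists (root_path x); have [] := root_pathP x.
move: lp; case: (shortenP Pp) => q Pq Uq sqp lq.
rewrite -(root_path_unique Pq lq Uq); apply: uniq_leq_size => //.
by case/andP: Uq.
Qed.

Lemma depth_parent x : tree_depth (parent x) = (tree_depth x).-1.
Proof.
rewrite !tree_depthE; have [e|->] := root_pathE x; last by [].
by rewrite /parent e /= e.
Qed.

Lemma depth0_root x : tree_depth x = 0 -> x = tree_root T.
Proof.
by rewrite tree_depthE => /size0nil e; have [_ <- _] := root_pathP x; rewrite e.
Qed.

Lemma depth_iter n x : tree_depth (iter n parent x) = (tree_depth x - n)%N.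
Proof. by elim: n => [|n IH] /=; rewrite ?subn0 // depth_parent IH subnS. Qed.

Lemma tree_leP x y : tree_le x y <-> exists n, x = iter n parent y.
Proof.
have -> : tree_le x y <-> x \in y :: root_path y.
  split=> [[p [Pp lp Up]]|h]; last by exists (root_path y); have [] := root_pathP y.
  by rewrite (root_path_unique Pp lp Up).
split.
  have [n] := ubnP (size (root_path y)); elim: n => // n IH in y *.
  move=> sz; rewrite inE => /orP[/eqP->|]; first by exists 0%N.
  have [e|e] := root_pathE y; first by rewrite e.
  rewrite e => /IH[|m ->]; first by rewrite e /= in sz.
  by exists m.+1; rewrite iterSr.
case=> n ->; elim: n y => [|n IH] y; first by rewrite inE eqxx.
rewrite iterSr; have := IH (parent y); have [e|->] := root_pathE y.
  by rewrite /parent e /= e.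
by move=> h; rewrite in_cons h orbT.
Qed.

Lemma tree_le_refl x : tree_le x x.
Proof. by apply/tree_leP; exists 0%N. Qed.

Lemma tree_le_iter n x : tree_le (iter n parent x) x.
Proof. by apply/tree_leP; exists n. Qed.

Lemma tree_le_trans y x z : tree_le x y -> tree_le y z -> tree_le x z.
Proof.
by move=> /tree_leP[n ->] /tree_leP[m ->]; apply/tree_leP; exists (n + m)%N; rewrite iterD.
Qed.

Lemma tree_le_depth x y : tree_le x y -> (tree_depth x <= tree_depth y)%N.
Proof. by move=> /tree_leP[n ->]; rewrite depth_iter leq_subr. Qed.

Lemma tree_le_iterE x y :
  tree_le x y -> x = iter (tree_depth y - tree_depth x) parent y.
Proof.
case/tree_leP=> n ->; rewrite depth_iter.
have [le_n|lt_n] := leqP n (tree_depth y); first by rewrite subKn.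
(* With more steps than the depth, both iterates have reached the root. *)
by rewrite (eqP (ltnW lt_n)) subn0 [LHS]depth0_root ?[RHS]depth0_root ?depth_iter //; lia.
Qed.

(* The ancestors of a vertex form a chain, ordered by depth. *)
Lemma tree_le_chain x y z : tree_le x z -> tree_le y z ->
  (tree_depth x <= tree_depth y)%N -> tree_le x y.
Proof.
move=> xz yz dxy; apply/tree_leP; exists (tree_depth y - tree_depth x)%N.
rewrite {2}(tree_le_iterE yz) -iterD {1}(tree_le_iterE xz).
by congr (iter _ _ _); have := tree_le_depth yz; lia.
Qed.

Lemma tree_le_depth_eq x y : tree_le x y -> tree_depth x = tree_depth y -> x = y.
Proof. by move=> xy e; rewrite (tree_le_iterE xy) e subnn. Qed.

Lemma tree_le_depth_inj x y z : tree_le x z -> tree_le y z ->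
  tree_depth x = tree_depth y -> x = y.
Proof.
by move=> xz yz e; apply: tree_le_depth_eq => //; apply: tree_le_chain xz yz _; rewrite e.
Qed.

(** * Pushing a finite set of vertices towards the root *)

(* [f] minimises the sum of [2 * depth (f s) + (f s != s)]: moving a value to a
   free parent, or exchanging two values to create a fixed point, would decrease
   it. *)
Lemma push_down_exists (X : {fset T}) : exists f : T -> T,
  [/\ {in X &, injective f}, forall s, s \in X -> tree_le (f s) s,
      forall s, s \in X -> exists2 s', s' \in X & f s' = parent (f s)
    & forall s, s \in X -> f s \in X -> f (f s) = f s].
Proof.
pose good f := {in X &, injective f} /\ forall s, s \in X -> tree_le (f s) s.
(* Depth counts twice, so that a step to the parent outweighs the loss of a fixed point. *)
pose cost (f : T -> T) s := (2 * tree_depth (f s) + (f s != s))%N.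
pose pot f := (\sum_(s <- X) cost f s)%N.
pose P n := `[< exists2 f, good f & pot f = n >].
have exP : exists n, P n.
  exists (pot id); apply/asboolP; exists id => //; split=> // s _.
  exact: tree_le_refl.
case: (ex_minnP exP) => n /asboolP[f [f_inj f_le] <-] minf.
have {exP}minf g : good g -> (pot f <= pot g)%N.
  by move=> gg; apply: minf; apply/asboolP; exists g.
exists f; split=> // [s sX | s sX fsX].
- apply: contrapT => no_s'.
  have neq t : t \in X -> f t != parent (f s).
    by move=> tX; apply/eqP => e; apply: no_s'; exists t.
  (* The root is its own parent, so [neq] at [s] itself keeps [f s] away from the root. *)
  have dfs : (0 < tree_depth (f s))%N.
    rewrite lt0n; apply/eqP => d0; have /eqP := neq s sX; apply.
    by rewrite [LHS]depth0_root // [RHS]depth0_root // depth_parent d0.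
  pose g t := if t == s then parent (f s) else f t.
  have /minf : good g.
    split=> [t u tX uX | t tX]; rewrite /g.
      case: eqVneq => [->|_]; case: eqVneq => [->|_] //; last exact: f_inj.
        by move=> /esym/eqP; rewrite (negPf (neq u uX)).
      by move=> /eqP; rewrite (negPf (neq t tX)).
    case: eqVneq => [->|_]; last exact: f_le.
    by apply: tree_le_trans (f_le _ sX); apply: (tree_le_iter 1).
  rewrite leqNgt => /negP; apply.
  rewrite /pot !(big_fsetD1 s sX) /=.
  rewrite (eq_big_seq (cost f)); last first.
    by move=> t; rewrite !inE /cost /g => /andP[/negPf-> _].
  by rewrite ltn_add2r /cost /g eqxx depth_parent; do 2 case: eqP => _ /=; lia.
- apply: contrapT => neq_a; set a := f s in fsX neq_a *.
  have neq_sa : s != a by apply/eqP => e; apply: neq_a; rewrite -e.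
  pose g t := if t == a then a else if t == s then f a else f t.
  have le_as : tree_le a s by exact: f_le.
  have /minf : good g.
    split=> [t u tX uX | t tX]; rewrite /g.
      have aE v : v \in X -> (f v = a) -> v = s by move=> vX /f_inj; apply.
      have faE v : v \in X -> (f v = f a) -> v = a by move=> vX /f_inj; apply.
      case: (eqVneq t a) => [->|ta]; case: (eqVneq u a) => [->|ua] //.
      - case: (eqVneq u s) => [_ /esym//|us /esym/aE e].
        by rewrite e ?eqxx in us.
      - case: (eqVneq t s) => [_ //|ts /aE e].
        by rewrite e ?eqxx in ts.
      - case: (eqVneq t s) => [->|ts]; case: (eqVneq u s) => [->|us] //.
        + by move=> /esym/faE e; rewrite e ?eqxx in ua.
        + by move=> /faE e; rewrite e ?eqxx in ta.
        + exact: f_inj.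
    case: eqVneq => [->|_]; first exact: tree_le_refl.
    case: eqVneq => [->|_]; last exact: f_le.
    exact: tree_le_trans (f_le _ fsX) le_as.
  rewrite leqNgt => /negP; apply.
  have sXa : s \in (X `\ a)%fset by rewrite !inE neq_sa.
  rewrite /pot !(big_fsetD1 a fsX) !(big_fsetD1 s sXa) /=.
  rewrite (eq_big_seq (cost f)); last first.
    by move=> t; rewrite !inE /cost /g => /and3P[/negPf-> /negPf-> _].
  rewrite !addnA ltn_add2r /cost /g eqxx (negPf neq_sa) eqxx -/a.
  have -> : f a != a by apply/eqP.
  rewrite eqxx [a == s]eq_sym neq_sa.
  by case: (f a != s) => /=; lia.
Qed.

(** * Counting in a down-closed set of one tree after a push *)

Definition down_closed (Z : set T) := forall x y, tree_le x y -> Z y -> Z x.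

(** On the way from the root up to [y], [x] is the first vertex outside [Y]. *)
Definition exits_at (Y : set T) x y :=
  [/\ tree_le x y, ~ Y x
    & forall z, tree_le z x -> (tree_depth z < tree_depth x)%N -> Y z].

Lemma exits_at_exists (Y : set T) y : ~ Y y -> exists x, exits_at Y x y.
Proof.
move=> nYy; pose P n := `[< exists x, [/\ tree_le x y, ~ Y x & tree_depth x = n] >].
have exP : exists n, P n.
  exists (tree_depth y); apply/asboolP; exists y; split=> //; exact: tree_le_refl.
case: (ex_minnP exP) => n /asboolP[x [xy nYx <-]] minx.
exists x; split=> // z zx; apply: contraPP => nYz; apply/negP; rewrite -leqNgt.
by apply: minx; apply/asboolP; exists z; split=> //; apply: tree_le_trans xy.
Qed.

Lemma exits_at_unique (Y : set T) x x' y :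
  exits_at Y x y -> exits_at Y x' y -> x = x'.
Proof.
move=> [xy nYx minx] [x'y nYx' minx'].
case: (ltngtP (tree_depth x) (tree_depth x')) => [lt|lt|/(tree_le_depth_inj xy x'y)//].
- by case: nYx; apply: (minx' _ _ lt); apply: tree_le_chain xy x'y (ltnW lt).
- by case: nYx'; apply: (minx _ _ lt); apply: tree_le_chain x'y xy (ltnW lt).
Qed.

Lemma exits_at_le (Y : set T) x y z :
  exits_at Y x y -> tree_le x z -> exits_at Y x z.
Proof. by case. Qed.

(* If [f a] has depth less than [m], let [x] be the lowest ancestor of [a] outside
   the image of [f]. At most [minn m (tree_depth x)] such [a] share a given [x], as
   the values of [f] at them lie on the path below [x]. Either some vertex of [Z]
   above [x] has depth at least [m + tree_depth x], and the path from [x] to it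
   has room for all of them, or each such [a] can be kept. *)
Lemma push_down_shift (X : {fset T}) (f : T -> T) (Z : set T) (m : nat) :
  {in X &, injective f} -> (forall s, s \in X -> tree_le (f s) s) ->
  (forall s, s \in X -> exists2 s', s' \in X & f s' = parent (f s)) ->
  (forall s, s \in X -> f s \in X -> f (f s) = f s) ->
  down_closed Z ->
  exists phi : T -> T,
    (forall a, a \in X -> Z a -> (m <= tree_depth a)%N ->
      [/\ Z (phi a), (m <= tree_depth (phi a))%N
        & exists2 s, s \in X & f s = iter m parent (phi a)]) /\
    (forall a b, a \in X -> Z a -> (m <= tree_depth a)%N ->
       b \in X -> Z b -> (m <= tree_depth b)%N -> phi a = phi b -> a = b).
Proof.
move=> f_inj f_le f_par f_fix Zdown.
pose Y : set T := [set y | exists2 s, s \in X & f s = y].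
have Ydown : down_closed Y.
  move=> x y /tree_leP[n ->]; elim: n => // n IH /IH[s sX e].
  by have [s' s'X e'] := f_par s sX; exists s' => //=; rewrite e' e.
have Yf a : a \in X -> Y (f a) by move=> aX; exists a.
pose R x b := [/\ Z b, tree_le x b & (m + tree_depth x <= tree_depth b)%N].
have /choice[top topP] : forall a, exists x, ~ Y a -> exits_at Y x a.
  move=> a; have [Ya|/exits_at_exists[x xP]] := pselect (Y a); last by exists x.
  by exists a.
have /choice[far farP] : forall x, exists c, (exists b, R x b) -> R x c.
  move=> x; have [[b Rb]|nR] := pselect (exists b, R x b); first by exists b.
  by exists x.
pose at_depth b k := iter (tree_depth b - k) parent b.
have at_le b k : tree_le (at_depth b k) b by exact: tree_le_iter.
have d_at b k : (k <= tree_depth b)%N -> tree_depth (at_depth b k) = k.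
  by move=> kb; rewrite depth_iter subKn.
(* In the second case the maximum puts the new vertex at depth at least [m] and not below [top a].
   The summand [tree_depth (f a)] separates different [a]; being less than both [m] and the depth of
   [top a], it keeps the vertex on the path to [far (top a)] and its [m]-th ancestor strictly below
   [top a], hence in [Y]. *)
pose phi a := if (m <= tree_depth (f a))%N then f a
  else if `[< exists b, R (top a) b >]
       then at_depth (far (top a)) (maxn m (tree_depth (top a)) + tree_depth (f a))
       else a.
have below_top a : a \in X -> ~ Y a ->
    tree_le (f a) (top a) /\ (tree_depth (f a) < tree_depth (top a))%N.
  move=> aX /topP[ta nYt _].
  have lt : (tree_depth (f a) < tree_depth (top a))%N.
    rewrite ltnNge; apply/negP => le; apply: nYt.
    by apply: Ydown (Yf _ aX); apply: tree_le_chain ta (f_le _ aX) le.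
  by split=> //; apply: tree_le_chain (f_le _ aX) ta (ltnW lt).
(* An element of [X] in the image is fixed by [f], so its value could not be less deep than
   itself. *)
have notY a : a \in X -> (m <= tree_depth a)%N -> (tree_depth (f a) < m)%N -> ~ Y a.
  move=> aX ma fm [s sX e]; move: (f_fix s sX); rewrite e => /(_ aX) fa.
  by move: fm; rewrite fa ltnNge ma.
have far_depth a : a \in X -> (tree_depth (f a) < m)%N -> ~ Y a ->
    (exists b, R (top a) b) ->
    let t := at_depth (far (top a)) (maxn m (tree_depth (top a)) + tree_depth (f a)) in
    [/\ tree_depth t = (maxn m (tree_depth (top a)) + tree_depth (f a))%N,
        tree_le (top a) t & Z t].
  move=> aX fm nYa /farP; set b := far _ => -[Zb tb db] t.
  have [_ lt] := below_top a aX nYa.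
  have dt : tree_depth t = (maxn m (tree_depth (top a)) + tree_depth (f a))%N.
    by apply: d_at; lia.
  split=> //; last exact: Zdown (at_le _ _) Zb.
  by apply: tree_le_chain tb (at_le _ _) _; rewrite -/t dt; lia.
(* The exit vertex of [a] can be recovered from [phi a]; injectivity rests on this. *)
have top_phi a : a \in X -> (m <= tree_depth a)%N -> (tree_depth (f a) < m)%N ->
    exits_at Y (top a) (phi a).
  move=> aX ma fm; have nYa := notY a aX ma fm.
  rewrite /phi leqNgt fm /=; case: asboolP => [far_ex|_]; last exact: topP.
  by apply: exits_at_le (topP _ nYa) _; have [] := far_depth a aX fm nYa far_ex.
exists phi; split.
  move=> a aX Za ma; rewrite /phi; case: leqP => [mf|fm].
    split=> //; first exact: Zdown (f_le _ aX) Za.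
    exact: Ydown (tree_le_iter _ _) (Yf _ aX).
  have nYa := notY a aX ma fm.
  have [_ lt] := below_top a aX nYa; have [ta nYt mint] := topP a nYa.
  case: asboolP => [far_ex|no_far].
    have [dt tt Zt] := far_depth a aX fm nYa far_ex.
    set t := at_depth _ _ in dt tt Zt *.
    split=> //; first by rewrite dt; lia.
    have dlt : (tree_depth (iter m parent t) < tree_depth (top a))%N.
      by rewrite depth_iter dt; lia.
    by apply: (mint _ _ dlt); apply: tree_le_chain (tree_le_iter _ _) tt (ltnW dlt).
  (* If the [m]-th ancestor of [a] were outside [Y], it would be at least as deep as [top a], and
     [a] itself would satisfy [R (top a)]. *)
  split=> //; apply: contrapT => nYi; apply: no_far; exists a; split=> //.
  rewrite -leq_subRL // -depth_iter leqNgt; apply/negP => dlt.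
  apply: nYi; apply: (mint _ _ dlt).
  by apply: tree_le_chain (tree_le_iter _ _) ta (ltnW dlt).
have sep a b : a \in X -> b \in X -> (m <= tree_depth b)%N ->
    (m <= tree_depth (f a))%N -> (tree_depth (f b) < m)%N -> phi a <> phi b.
  move=> aX bX mb mf fm e; have [tb nYt _] := top_phi b bX mb fm.
  by apply: nYt; apply: Ydown tb _; rewrite -e /phi mf; apply: Yf.
move=> a b aX Za ma bX Zb mb e.
have [mfa|fam] := leqP m (tree_depth (f a)); have [mfb|fbm] := leqP m (tree_depth (f b)).
- by move: e; rewrite /phi mfa mfb => /f_inj; apply.
- by case: (sep a b).
- by case: (sep b a).
have tab : top a = top b.
  by apply: exits_at_unique (top_phi a aX ma fam) _; rewrite e; apply: top_phi.
have nYa := notY a aX ma fam; have nYb := notY b bX mb fbm.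
move: e; rewrite /phi (ltn_geF fam) (ltn_geF fbm) -tab; case: asboolP => [far_ex|] // e.
have [da _ _] := far_depth a aX fam nYa far_ex.
rewrite tab in far_ex; have [db _ _] := far_depth b bX fbm nYb far_ex.
have [fa _] := below_top a aX nYa; have [fb _] := below_top b bX nYb.
(* Both values lie on the path to the common exit, so they agree once their depths, read off from
   [da] and [db], do. *)
apply: f_inj => //; rewrite -tab in fb; apply: tree_le_depth_inj fa fb _.
by move: da; rewrite e tab db => /addnI.
Qed.

(** Cardinality comparisons are expressed by injections, which can be applied in all fibres of a
    product at once. One [X'] serves all [Z] and [m]. *)
Definition pushed_down (X X' : set T) : Prop :=
  (exists psi : T -> T, (forall y, X' y -> X (psi y)) /\
     (forall y z, X' y -> X' z -> psi y = psi z -> y = z)) /\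
  (forall (Z : set T) (m : nat), down_closed Z -> exists phi : T -> T,
     (forall a, X a /\ Z a /\ (m <= tree_depth a)%N ->
       [/\ Z (phi a), (m <= tree_depth (phi a))%N & X' (iter m parent (phi a))]) /\
     (forall a b, X a /\ Z a /\ (m <= tree_depth a)%N ->
       X b /\ Z b /\ (m <= tree_depth b)%N -> phi a = phi b -> a = b)).

Lemma push_down (X : set T) : finite_set X -> exists X', pushed_down X X'.
Proof.
move=> /finite_fsetP[A ->]; have [f [f_inj f_le f_par f_fix]] := push_down_exists A.
exists [set y | exists2 s, s \in A & f s = y]; split.
- have /choice[psi psiP] : forall y, exists s, (exists2 s, s \in A & f s = y) ->
      s \in A /\ f s = y.
    move=> y; have [[s sA e]|n] := pselect (exists2 s, s \in A & f s = y).
      by exists s.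
    by exists y.
  exists psi; split=> [y /psiP[]//|y z /psiP[_ ey] /psiP[_ ez] e].
  by rewrite -ey -ez e.
- move=> Z m Zdown.
  have [phi [phiP phi_inj]] := push_down_shift m f_inj f_le f_par f_fix Zdown.
  exists phi; split=> [a [aA [Za ma]]|a b [aA [Za ma]] [bA [Zb mb]]].
    exact: phiP.
  exact: phi_inj.
Qed.

End Tree.

Lemma card_filter_fset (K : choiceType) (A : {fset K}) (P : pred K) :
  #|` [fset x in A | P x]%fset| = (\sum_(x <- A) P x)%N.
Proof. by rewrite card_fset_sum1 -big_fset_condE big_mkcond. Qed.

(** * Fibres and ancestors in the product of trees *)

Section Product.
Variables (d : nat) (T : 'I_d -> rooted_tree).
Implicit Types (v w : tree_prod T) (m : {ffun 'I_d -> nat}) (S : {fset tree_prod T}).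

Definition update (j : 'I_d) v (t : T j) : tree_prod T :=
  [ffun i => dfwith (fun k => v k) t i].

Lemma update_in j v (t : T j) : update v t j = t.
Proof. by rewrite ffunE dfwith_in. Qed.

Lemma update_out j v (t : T j) i : j != i -> update v t i = v i.
Proof. by move=> ji; rewrite ffunE dfwith_out. Qed.

Lemma update_eq j v w (t : T j) :
  w j = t -> (forall i, j != i -> w i = v i) -> update v t = w.
Proof.
move=> <- vw; apply/ffunP => i; have [<-|ji] := eqVneq j i.
  by rewrite update_in.
by rewrite update_out // vw.
Qed.

Lemma update_id j v : update v (v j) = v.
Proof. exact: update_eq. Qed.

Lemma update_update j v (t u : T j) : update (update v t) u = update v u.
Proof.
by apply: update_eq => [|i ji]; rewrite ?update_in // !update_out.
Qed.

(** Changing only coordinate [j], by a map that depends only on the fibre, preserves fibres;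
    injectivity inside each fibre is therefore enough. *)
Lemma leq_card_fiberwise j (A B : {fset tree_prod T}) (phi : tree_prod T -> T j -> T j) :
  (forall v (t : T j), phi (update v t) = phi v) ->
  (forall v, v \in A -> update v (phi v (v j)) \in B) ->
  (forall v (t : T j), v \in A -> update v t \in A ->
     phi v (v j) = phi v t -> v j = t) ->
  (#|` A| <= #|` B|)%N.
Proof.
move=> phi_upd phiB phi_inj.
pose F v := update v (phi v (v j)).
have F_inj : {in A &, injective F}.
  move=> v w vA wA e.
  have wE : update v (w j) = w.
    apply: update_eq => // i ji; have := congr1 (fun u : tree_prod T => u i) e.
    by rewrite /F !update_out.
  have phiE : phi w = phi v by rewrite -wE phi_upd.
  have := congr1 (fun u : tree_prod T => u j) e; rewrite /F !update_in phiE.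
  by move/(phi_inj v) => e'; rewrite -wE -e' ?update_id // wE.
rewrite -(card_in_imfset imfset_key F_inj) /=; apply: fsubset_leq_card.
by apply/fsubsetP => _ /imfsetP[v /= vA ->]; apply: phiB.
Qed.

Definition ancestor (n : nat) m w : tree_prod T :=
  [ffun i : 'I_d => iter (if (i < n)%N then m i else 0%N) (@parent (T i)) (w i)].

Definition deep m w := [forall i, (m i <= tree_depth (w i))%N].

Lemma ancestor_le n m w : prod_le (ancestor n m w) w.
Proof. by move=> i; rewrite ffunE; apply: tree_le_iter. Qed.

Lemma ancestor0 m w : ancestor 0 m w = w.
Proof. by apply/ffunP => i; rewrite ffunE. Qed.

(** Since [ancestor] stops at the root, [deep] ensures that exactly [m i] steps down are made in
    each tree. *)
Lemma arrow_byP m v w : `[< arrow_by m v w >] = deep m w && (v == ancestor d m w).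
Proof.
apply/asboolP/andP => [vw|[/forallP mw /eqP->] i].
  split; first by apply/forallP => i; have [_] := vw i; lia.
  apply/eqP/ffunP => i; rewrite ffunE ltn_ord; have [le e] := vw i.
  by rewrite {1}(tree_le_iterE le); congr (iter _ _ _); lia.
split; first exact: ancestor_le.
by rewrite ffunE ltn_ord depth_iter; have := mw i; lia.
Qed.

(** * Treating the coordinates of a finite ideal one after the other *)

Variable Omega : {fset tree_prod T}.
Hypothesis Omega_ideal : lower_ideal Omega.

(* Interpolates between the elements of [S] of depth at least [m] ([n = 0]) and
   the elements of [Omega] whose [m]-th ancestor is in [S] ([n = d]). *)
Definition hybrid (n : nat) m S : {fset tree_prod T} :=
  [fset w in Omega | deep m w && (ancestor n m w \in S)]%fset.

Lemma ancestor_mem n m w : w \in Omega -> ancestor n m w \in Omega.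
Proof. exact/Omega_ideal/ancestor_le. Qed.

(** Every fibre of [S] in direction [j] is pushed down, before any [m] is chosen. For given [m], the
    single-tree comparison in each fibre of [Omega] provides an injection between the two
    hybrids. *)
Lemma hybrid_step (j : 'I_d) S : exists S',
  [/\ (S' `<=` Omega)%fset, (#|` S'| <= #|` S|)%N
    & forall m, (#|` hybrid j m S| <= #|` hybrid j.+1 m S'|)%N].
Proof.
pose fiber (A : {fset tree_prod T}) v : set (T j) := [set t | update v t \in A].
have fiber_upd A v (t : T j) : fiber A (update v t) = fiber A v.
  by apply: funext => u; rewrite /fiber /= update_update.
have fiber_fin A v : finite_set (fiber A v).
  apply: (@sub_finite_set _ _ ((fun w : tree_prod T => w j) @` [set` A])).
    by move=> t /= tA; exists (update v t); rewrite ?update_in.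
  exact: finite_image.
have fiber_down v : down_closed (fiber Omega v).
  move=> x y xy; apply: Omega_ideal => i; have [<-|ji] := eqVneq j i.
    by rewrite !update_in.
  by rewrite !update_out //; apply: tree_le_refl.
(* The choice depends on the set alone, so all points of one fibre use the same pushed set. *)
have /choice[push pushP] : forall X : set (T j), exists X',
    finite_set X -> pushed_down X X'.
  move=> X; have [/push_down[X' XX']|] := pselect (finite_set X); first by exists X'.
  by exists set0.
(* Restricting to [Omega] makes [S'] finite. The points whose membership is needed below are
   ancestors of points of [Omega]. *)
pose S' := [fset v in Omega | `[< push (fiber S v) (v j) >]]%fset.
exists S'; split.
- by apply/fsubsetP => v; rewrite !inE => /andP[].
- have /choice[psi psiP] : forall X : set (T j), exists psi : T j -> T j,
      finite_set X -> (forall y, push X y -> X (psi y)) /\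
        (forall y z, push X y -> push X z -> psi y = psi z -> y = z).
    move=> X; have [/pushP[[psi ?] _]|] := pselect (finite_set X); first by exists psi.
    by exists id.
  apply: (@leq_card_fiberwise j _ _ (fun v => psi (fiber S v))).
  + by move=> v t; rewrite fiber_upd.
  + move=> v; rewrite !inE => /andP[_ /asboolP pv].
    by have [mem_psi _] := psiP _ (fiber_fin S v); apply: mem_psi.
  + move=> v t; rewrite !inE => /andP[_ /asboolP pv] /andP[_ /asboolP].
    rewrite fiber_upd update_in => pt.
    by have [_ inj_psi] := psiP _ (fiber_fin S v); apply: inj_psi.
- move=> m.
  have /choice[phi phiP] : forall XZ : set (T j) * set (T j),
      exists phi : T j -> T j, finite_set XZ.1 -> down_closed XZ.2 ->
      (forall a, XZ.1 a /\ XZ.2 a /\ (m j <= tree_depth a)%N ->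
         [/\ XZ.2 (phi a), (m j <= tree_depth (phi a))%N
           & push XZ.1 (iter (m j) (@parent (T j)) (phi a))]) /\
      (forall a b, XZ.1 a /\ XZ.2 a /\ (m j <= tree_depth a)%N ->
         XZ.1 b /\ XZ.2 b /\ (m j <= tree_depth b)%N -> phi a = phi b -> a = b).
    move=> [X Z] /=; have [/pushP[_ XP]|] := pselect (finite_set X); last by exists id.
    have [/(XP Z (m j))[phi ?]|] := pselect (down_closed Z); first by exists phi.
    by exists id.
  have anc_upd v (t : T j) : ancestor j m (update v t) = update (ancestor j m v) t.
    apply/esym/update_eq => [|i ji]; first by rewrite ffunE ltnn update_in.
    by rewrite !ffunE dfwith_out.
  have anc_next v (t : T j) :
      ancestor j.+1 m (update v t) = update (ancestor j m v) (iter (m j) (@parent (T j)) t).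
    apply/esym/update_eq => [|i ji]; first by rewrite ffunE ltnSn update_in.
    rewrite !ffunE dfwith_out // ltnS leq_eqVlt; congr (iter _ _ _).
    by case: eqP => // /val_inj ij; rewrite ij eqxx in ji.
  have fibP w : w \in hybrid j m S -> fiber S (ancestor j m w) (w j) /\
      fiber Omega w (w j) /\ (m j <= tree_depth (w j))%N.
    rewrite !inE => /and3P[wO /forallP mw aS]; split; last first.
      by split=> //; rewrite /fiber /= update_id.
    rewrite /fiber /= (_ : w j = ancestor j m w j) ?update_id //.
    by rewrite ffunE ltnn.
  (* The two fibres have different base points: that of [S] passes through the partial ancestor of
     [w], that of [Omega] through [w]. Neither changes when coordinate [j] of [w] does. *)
  pose Phi w := phi (fiber S (ancestor j m w), fiber Omega w).
  apply: (@leq_card_fiberwise j _ _ Phi).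
  + by move=> w t; rewrite /Phi anc_upd !fiber_upd.
  + move=> w wh.
    have [mem_phi _] := phiP (_, _) (fiber_fin S (ancestor j m w)) (fiber_down w).
    have [/= Zw mw pw] := mem_phi _ (fibP _ wh).
    move: wh; rewrite !inE => /and3P[wO /forallP dw aS].
    apply/and3P; split=> //.
      apply/forallP => i; have [<-|ji] := eqVneq j i; first by rewrite update_in.
      by rewrite update_out.
    rewrite ancestor_mem //=; apply/asboolP.
    by rewrite anc_next fiber_upd update_in.
  + move=> w t wh uh.
    have [_ inj_phi] := phiP (_, _) (fiber_fin S (ancestor j m w)) (fiber_down w).
    apply: inj_phi; first exact: fibP.
    by have := fibP _ uh; rewrite anc_upd !fiber_upd update_in.
Qed.

Lemma hybrid_exists n S : (n <= d)%N -> (S `<=` Omega)%fset -> exists S',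
  [/\ (S' `<=` Omega)%fset, (#|` S'| <= #|` S|)%N
    & forall m, (#|` hybrid 0 m S| <= #|` hybrid n m S'|)%N].
Proof.
move=> + SO; elim: n => [|n IH] nd; first by exists S.
have [S1 [S1O S1S h1]] := IH (ltnW nd).
have [S2 [S2O S2S h2]] := hybrid_step (Ordinal nd) S1.
exists S2; split=> //; first exact: leq_trans S1S.
by move=> m; apply: leq_trans (h1 m) (h2 m).
Qed.

(** * Double counting of the pairs related by [arrow_by] *)

Lemma sum_up_card m S :
  (\sum_(v <- S) #|` [fset w in Omega | `[< arrow_by m v w >]]%fset|)%N
  = #|` hybrid d m S|.
Proof.
rewrite card_filter_fset; under eq_bigr do rewrite card_filter_fset.
(* For fixed [w], only its [m]-th ancestor can be counted among the [v] in [S]. *)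
rewrite exchange_big /=; apply: eq_bigr => w _.
under eq_bigr do rewrite arrow_byP -mulnb.
rewrite -big_distrr /= -mulnb -count_uniq_mem ?fset_uniq // -sum1_count.
by rewrite [in RHS]big_mkcond.
Qed.

(** Each deep [v] in [S] contributes one [w], its [m]-th ancestor, which is in [Omega] because
    [Omega] is an ideal. *)
Lemma sum_down_card m S : (S `<=` Omega)%fset ->
  (\sum_(v <- S) #|` [fset w in Omega | `[< arrow_by m w v >]]%fset|)%N
  = #|` hybrid 0 m S|.
Proof.
move=> SO; have -> : hybrid 0 m S = [fset w in S | deep m w]%fset.
  apply/fsetP => w; rewrite !inE ancestor0 andbA andbC; case wS: (w \in S) => //=.
  by rewrite (fsubsetP SO).
rewrite card_filter_fset; apply: eq_big_seq => v vS.
rewrite card_filter_fset; under eq_bigr do rewrite arrow_byP -mulnb.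
rewrite -big_distrr /=.
have -> : (\sum_(w <- Omega) (w == ancestor d m v) = 1)%N.
  have := count_uniq_mem (ancestor d m v) (fset_uniq Omega).
  rewrite ancestor_mem ?(fsubsetP SO) // -sum1_count big_mkcond => cnt.
  by apply: etrans cnt; apply: eq_bigr => w _ /=; case: eqP.
by rewrite muln1.
Qed.

(** Ancestors stay in the ideal, so both sides count its deep elements; this gives the equality of
    the total sums. *)
Lemma hybrid_full m : #|` hybrid 0 m Omega| = #|` hybrid d m Omega|.
Proof.
congr #|` _|; apply/fsetP => w; rewrite !inE; case wO: (w \in Omega) => //=.
by rewrite !ancestor_mem.
Qed.

Definition shift v w : {ffun 'I_d -> nat} :=
  [ffun i : 'I_d => (tree_depth (w i) - tree_depth (v i))%N].

(** A finite set outside which all terms of [upsum] and [downsum] vanish at points of [Omega]. *)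
Definition shifts : {fset {ffun 'I_d -> nat}} :=
  [fset shift v w | v in Omega, w in Omega]%fset.

Lemma arrow_by_shifts m v w :
  v \in Omega -> w \in Omega -> arrow_by m v w -> m \in shifts.
Proof.
move=> vO wO vw; apply/imfset2P; exists v => //; exists w => //.
apply/ffunP => i; rewrite ffunE.
suff: m i = (tree_depth (w i) - tree_depth (v i))%N :> nat by [].
by have [_] := vw i; lia.
Qed.

Variables (R : realType) (g : {ffun 'I_d -> nat} -> R).

Lemma upsumE v : v \in Omega -> upsum Omega g v =
  \sum_(m <- shifts) g m * #|` [fset w in Omega | `[< arrow_by m v w >]]%fset |%:R.
Proof.
move=> vO; apply: fsbigTE => m mM.
rewrite (_ : [fset _ in _ | _]%fset = fset0) ?cardfs0 ?mulr0 //.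
apply/fsetP => w; rewrite !inE; apply/andP => -[wO /asboolP vw].
by rewrite (arrow_by_shifts vO wO vw) in mM.
Qed.

Lemma downsumE v : v \in Omega -> downsum Omega g v =
  \sum_(m <- shifts) g m * #|` [fset w in Omega | `[< arrow_by m w v >]]%fset |%:R.
Proof.
move=> vO; apply: fsbigTE => m mM.
rewrite (_ : [fset _ in _ | _]%fset = fset0) ?cardfs0 ?mulr0 //.
apply/fsetP => w; rewrite !inE; apply/andP => -[wO /asboolP vw].
by rewrite (arrow_by_shifts wO vO vw) in mM.
Qed.

Lemma sum_upsum S : (S `<=` Omega)%fset ->
  \sum_(v <- S) upsum Omega g v = \sum_(m <- shifts) g m * #|` hybrid d m S|%:R.
Proof.
move=> SO; rewrite (eq_big_seq _ (fun v vS => upsumE (fsubsetP SO v vS))).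
rewrite exchange_big /=; apply: eq_bigr => m _.
by rewrite -mulr_sumr -natr_sum sum_up_card.
Qed.

Lemma sum_downsum S : (S `<=` Omega)%fset ->
  \sum_(v <- S) downsum Omega g v = \sum_(m <- shifts) g m * #|` hybrid 0 m S|%:R.
Proof.
move=> SO; rewrite (eq_big_seq _ (fun v vS => downsumE (fsubsetP SO v vS))).
rewrite exchange_big /=; apply: eq_bigr => m _.
by rewrite -mulr_sumr -natr_sum sum_down_card.
Qed.

End Product.

(** * Majorization from a comparison of subset sums *)

Section Majorization.
Variables (R : realType) (K : choiceType).
Implicit Types (A S : {fset K}) (F G : K -> R).

Lemma mset_image_perm A F : perm_eq (enum_mset (mset_image A F)) [seq F x | x <- A].
Proof. exact: perm_eq_seq_mset. Qed.

(** Sorting elements instead of values turns a top sum into a sum over a subset of [A]. *)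
Definition sorted_by A F : seq K := sort (relpre F >=%R) A.

Lemma largest_sumE A F k :
  largest_sum k (mset_image A F) = \sum_(x <- take k (sorted_by A F)) F x.
Proof.
rewrite /largest_sum (_ : sort _ _ = map F (sorted_by A F)).
  by rewrite -map_take big_map.
rewrite -sort_map; apply/perm_sortP; last exact: mset_image_perm.
- by move=> x y; apply: le_total.
- exact: ge_trans.
- exact: ge_anti.
Qed.

(** With [c] the value of rank [k + 1], any sum over [S] is at most the sum over [A] of the positive
    parts of [F - c], plus [k] times [c]; the top [k] elements attain this bound. As [S] may have
    fewer than [k] elements, [c] must be nonnegative. *)
Lemma sum_le_largest A F S k : (forall x, x \in A -> 0 <= F x) ->
  (S `<=` A)%fset -> (#|` S| <= k)%N -> (k < #|` A|)%N ->
  \sum_(x <- S) F x <= largest_sum k (mset_image A F).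
Proof.
move=> F0 SA Sk kA; rewrite largest_sumE.
set s := sorted_by A F.
have s_mem x : (x \in s) = (x \in A) by rewrite mem_sort.
have s_size : size s = #|` A| by rewrite size_sort.
have s_sorted : sorted (relpre F >=%R) s.
  by apply: sort_sorted => x y; apply: le_total.
have s_trans : transitive (relpre F >=%R) by move=> y x z; apply: ge_trans.
have [x [u dropE]] : exists x u, drop k s = x :: u.
  case E: (drop k s) => [|x u]; last by exists x, u.
  by have := size_drop k s; rewrite E s_size /=; lia.
move: s_sorted; rewrite sorted_pairwise // -{1}(cat_take_drop k s) dropE pairwise_cat /=.
case/and3P=> /allrelP tP _ /andP[/allP uP _].
have x_s : x \in s by rewrite -(cat_take_drop k s) dropE mem_cat !inE eqxx orbT.
set t := take k s in tP *.
pose c := F x; pose h y := Num.max (F y - c) 0.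
have c0 : 0 <= c by apply: F0; rewrite -s_mem.
have h0 y : 0 <= h y by rewrite le_max lexx orbT.
have -> : \sum_(y <- t) F y = \sum_(y <- s) h y + k%:R * c.
  rewrite -(cat_take_drop k s) dropE big_cat /= -/t [X in _ + X + _]big1_seq; last first.
    move=> y /andP[_ yu]; apply/max_idPr; rewrite subr_le0.
    by move: yu; rewrite inE => /orP[/eqP->//|/uP].
  have -> : \sum_(y <- t) h y = \sum_(y <- t) (F y - c).
    apply: eq_big_seq => y yt; apply/max_idPl; rewrite subr_ge0.
    by apply: tP => //; rewrite inE eqxx.
  rewrite sumrB big_const_seq count_predT iter_addr_0 size_takel ?s_size ?(ltnW kA) //.
  by rewrite mulr_natl addr0 subrK.
have -> : \sum_(y <- S) F y = \sum_(y <- S) (F y - c) + #|` S|%:R * c.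
  by rewrite sumrB big_const_seq count_predT iter_addr_0 mulr_natl subrK.
apply: lerD; last by rewrite ler_wpM2r // ler_nat.
apply: (@le_trans _ _ (\sum_(y <- S) h y)).
  by apply: ler_sum => y _; rewrite le_max lexx.
have -> : S = [fset y in A | y \in S]%fset.
  apply/fsetP => y; rewrite !inE; case yS: (y \in S); last by rewrite andbF.
  by rewrite (fsubsetP SA).
rewrite -big_fset_condE (perm_big s) /=; last by rewrite perm_sym perm_sort.
by rewrite [leRHS](bigID (mem S)) /= lerDl sumr_ge0.
Qed.

Lemma largest_sum_attained A F k : (k <= #|` A|)%N -> exists S,
  [/\ (S `<=` A)%fset, #|` S| = k & largest_sum k (mset_image A F) = \sum_(x <- S) F x].
Proof.
move=> kA; set t := take k (sorted_by A F).
have t_uniq : uniq t by rewrite take_uniq // sort_uniq fset_uniq.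
have perm_t : perm_eq [fset x in t]%fset t.
  by apply: uniq_perm => // x; rewrite !inE.
exists [fset x in t]%fset; split.
- by apply/fsubsetP => x; rewrite !inE => /mem_take; rewrite mem_sort.
- by rewrite /= (perm_size perm_t) size_takel // size_sort.
- by rewrite largest_sumE (perm_big _ perm_t).
Qed.

(** Apply the subset comparison to a set [S] attaining the top sum of [G]; the resulting [S'] has at
    most [k] elements, so [sum_le_largest] bounds its sum. *)
Lemma majorizes_mset_image A F G :
  (forall x, x \in A -> 0 <= F x) ->
  \sum_(x <- A) F x = \sum_(x <- A) G x ->
  (forall S, (S `<=` A)%fset -> exists S', [/\ (S' `<=` A)%fset, (#|` S'| <= #|` S|)%N
     & \sum_(x <- S) G x <= \sum_(x <- S') F x]) ->
  majorizes (mset_image A F) (mset_image A G).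
Proof.
move=> F0 sumE dom; have size_img (H : K -> R) : size (enum_mset (mset_image A H)) = #|` A|.
  by rewrite (perm_size (mset_image_perm A H)) size_map.
split; first by rewrite !size_img.
  move=> k; rewrite size_img => /andP[_ kA].
  have [S [SA Sk ->]] := largest_sum_attained G (ltnW kA).
  have [S' [S'A S'S le_sum]] := dom S SA; apply: le_trans le_sum _.
  by apply: sum_le_largest; rewrite // -Sk.
by rewrite !(perm_big _ (mset_image_perm A _)) /= !big_map.
Qed.

End Majorization.

Theorem theorem6p1 (R : realType) (d : nat) (T : 'I_d -> rooted_tree)
    (T_infinite : forall i, infinite_set [set: T i])
    (T_locally_finite : forall i, locally_finite (T i))
    (Omega : {fset tree_prod T}) (Omega_ideal : lower_ideal Omega)
    (g : {ffun 'I_d -> nat} -> R) (g_ge0 : forall m, 0 <= g m) :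
  majorizes (mset_image Omega (upsum Omega g))
            (mset_image Omega (downsum Omega g)).
Proof.
apply: majorizes_mset_image => [v vO | | S SO].
- by rewrite upsumE //; apply: sumr_ge0 => m _; rewrite mulr_ge0.
- rewrite sum_upsum // sum_downsum //; apply: eq_bigr => m _.
  by rewrite hybrid_full.
- have [S' [S'O S'S hybS]] := hybrid_exists Omega_ideal (leqnn d) SO.
  exists S'; split=> //; rewrite sum_upsum // sum_downsum //.
  (* The same [S'] works for every [m], so the cardinalities compare term by term and the weights
     [g m] keep the inequality. *)
  by apply: ler_sum => m _; rewrite ler_wpM2l // ler_nat.
Qed.
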